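(* Let $G$ be a finite group. Then $\gamma(\mathcal{D}(G))=1$ if and only if $G$ is a $\Phi$-group. Moreover, if $\gamma(\mathcal{D}(G))=1$, then $\{u\}$ is the unique dominating set of size one in $\mathcal{D}(G)$, where $u$ is the unique involution in $G$ such that there exists at least one element of odd prime order that commutes with $u$.
   Context: All groups are finite; $e$ is the identity, $o(g)$ is the order of $g$, and an involution is an element of order $2$. The power graph $\mathcal{P}(G)$ is the simple graph with vertex set $G$ in which two distinct vertices are adjacent if one is a power of the other. The enhanced power graph $\mathcal{P}_E(G)$ is the simple graph with vertex set $G$ in which two distinct vertices $x,y$ are adjacent if $\langle x,y\rangle$ is cyclic. The difference graph $\mathcal{D}(G)$ is obtained from the graph $\mathcal{P}_E(G)-\mathcal{P}(G)$ (vertex set $G$, edges those of $\mathcal{P}_E(G)$ that are not edges of $\mathcal{P}(G)$) by removing all isolated vertices. If no vertices remain, $\mathcal{D}(G)$ is regarded as not defined, and $\gamma(\mathcal{D}(G))=1$ does not hold. A dominating set of a graph $\Gamma$ is a set $D\subseteq V(\Gamma)$ such that every vertex is in $D$ or adjacent to some vertex of $D$; $\gamma(\Gamma)$ is the minimum size of a dominating set. A maximal cyclic subgroup of $G$ is a cyclic subgroup not properly contained in another cyclic subgroup of $G$. A finite group $G$ is a $\Phi$-group if the following three conditions hold: (a) there exists a unique involution in $G$ that commutes with at least one element of odd prime order; denote this involution by $u$; (b) for every non-trivial element $g\in G$ of odd order, one of the following holds: $\langle g\rangle$ is a maximal cyclic subgroup of $G$; or every cyclic subgroup of $G$ containing $g$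 has prime-power order; or $g$ has prime order and commutes with $u$; (c) for every element $g\in G\setminus\{u\}$ of even order, either $\langle g\rangle$ is a maximal cyclic subgroup of $G$, or every cyclic subgroup of $G$ containing $g$ has prime-power order. *)

(* Defs.v *)
From mathcomp Require Import all_boot fingroup cyclic.

Set Implicit Arguments.
Unset Strict Implicit.
Unset Printing Implicit Defensive.

Local Open Scope group_scope.

(* The relation [adj] is only meaningful between elements of [verts]. *)
Record sgraph (T : finType) := SGraph {
  verts : {set T};
  adj : rel T;
  adj_sym : symmetric adj;
  adj_irr : irreflexive adj
}.

Section Graphs.
Variable T : finType.
Implicit Types (Gr : sgraph T) (D : {set T}).

Definition sub_adj Gr1 Gr2 : rel T :=
  [rel x y | adj Gr1 x y && ~~ adj Gr2 x y].

Lemma sub_adj_sym Gr1 Gr2 : symmetric (sub_adj Gr1 Gr2).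
Proof. by move=> x y; rewrite /sub_adj /= (adj_sym Gr1) (adj_sym Gr2). Qed.

Lemma sub_adj_irr Gr1 Gr2 : irreflexive (sub_adj Gr1 Gr2).
Proof. by move=> x; rewrite /sub_adj /= adj_irr. Qed.

Definition sub_edges Gr1 Gr2 : sgraph T :=
  SGraph (verts Gr1) (@sub_adj_sym Gr1 Gr2) (@sub_adj_irr Gr1 Gr2).

Definition del_isolated Gr : sgraph T :=
  SGraph [set x in verts Gr | [exists y in verts Gr, adj Gr x y]]
         (@adj_sym _ Gr) (@adj_irr _ Gr).

Definition dominating Gr D : bool :=
  (D \subset verts Gr) &&
  [forall x in verts Gr, (x \in D) || [exists y in D, adj Gr x y]].

Lemma dominating_verts Gr : dominating Gr (verts Gr).
Proof. by apply/andP; split=> //; apply/forall_inP=> x ->. Qed.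

(* The minimum is attained, by [dominating_verts]. It is 0 exactly when the
   graph has no vertex, so [domination_number Gr = 1] fails in that case. *)
Definition domination_number Gr : nat :=
  #|[arg min_(D < verts Gr | dominating Gr D) #|D|]|.

End Graphs.

Section PowerGraphs.
Variable gT : finGroupType.
Implicit Types (G : {group gT}) (x y : gT).

Definition power_adj : rel gT :=
  [rel x y | (x != y) && ((x \in <[y]>) || (y \in <[x]>))].

Lemma power_adj_sym : symmetric power_adj.
Proof. by move=> x y; rewrite /power_adj /= eq_sym orbC. Qed.

Lemma power_adj_irr : irreflexive power_adj.
Proof. by move=> x; rewrite /power_adj /= eqxx. Qed.

Definition enhanced_power_adj : rel gT :=
  [rel x y | (x != y) && cyclic <<[set x; y]>>].

Lemma enhanced_power_adj_sym : symmetric enhanced_power_adj.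
Proof. by move=> x y; rewrite /enhanced_power_adj /= eq_sym setUC. Qed.

Lemma enhanced_power_adj_irr : irreflexive enhanced_power_adj.
Proof. by move=> x; rewrite /enhanced_power_adj /= eqxx. Qed.

Definition power_graph G : sgraph gT :=
  SGraph G power_adj_sym power_adj_irr.

Definition enhanced_power_graph G : sgraph gT :=
  SGraph G enhanced_power_adj_sym enhanced_power_adj_irr.

Definition difference_graph G : sgraph gT :=
  del_isolated (sub_edges (enhanced_power_graph G) (power_graph G)).

End PowerGraphs.

Section PhiGroups.
Variable gT : finGroupType.
Implicit Types (G C : {group gT}) (u g : gT).

Definition maximal_cyclic G (A : {set gT}) : bool :=
  [max A of C | (C \subset G) && cyclic C].

Definition prime_power (n : nat) : Prop :=
  exists p k : nat, [/\ prime p, (0 < k)%N & n = (p ^ k)%N].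

Definition all_cyclic_overgroups_prime_power G g : Prop :=
  forall C, C \subset G -> cyclic C -> g \in C -> prime_power #|C|.

Definition involution_commuting_odd_prime G u : Prop :=
  [/\ u \in G, #[u] = 2 &
      exists2 g, g \in G & [/\ prime #[g], odd #[g] & commute u g]].

Definition Phi_group G : Prop :=
  exists u, [/\ unique (involution_commuting_odd_prime G) u,
    forall g, g \in G -> g != 1 -> odd #[g] ->
      [\/ maximal_cyclic G <[g]>,
          all_cyclic_overgroups_prime_power G g |
          prime #[g] /\ commute g u] &
    forall g, g \in G -> g != u -> ~~ odd #[g] ->
      maximal_cyclic G <[g]> \/ all_cyclic_overgroups_prime_power G g].

End PhiGroups.

(* Main.v *)
Require Import Defs.
From mathcomp Require Import all_boot fingroup cyclic.

(** In a cyclic group, two elements are adjacent in the difference graph iff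
    their orders are incomparable for divisibility.  Hence [g != 1] is isolated
    iff [<[g]>] is maximal cyclic or all its cyclic overgroups have prime-power
    order.  A dominating vertex [d] is an involution, since [d] and [d^-1] have
    the same neighbours but are never adjacent to each other; and the neighbours
    of an involution [u] are the non-trivial elements of odd order commuting
    with [u].  If such a [g] had composite order, [g] would be adjacent to [g'u]
    for any [g'] generating a proper non-trivial subgroup of [<[g]>], while
    [g'u] is not adjacent to [u]. *)

Set Implicit Arguments.
Unset Strict Implicit.
Unset Printing Implicit Defensive.

Local Open Scope group_scope.

(** For a prime [p] dividing [n %/ m], the [p]-part of [n] is too large to divide [m], so by
    comparability [m] divides it, and [m] is a power of [p]. A prime [q] dividing [n] is also
    comparable with [m], and either direction forces [q] to be [p]. *)
Lemma prime_power_of_comparable_divisors (m n : nat) :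
    (1 < m)%N -> (0 < n)%N -> (m %| n)%N -> m != n ->
    (forall k, k %| n -> (k %| m) || (m %| k))%N ->
  prime_power n.
Proof.
move=> m_gt1 n_gt0 dvd_mn neq_mn cmp; have m_gt0 := ltnW m_gt1.
have q_gt1: (1 < n %/ m)%N.
  rewrite ltn_neqAle divn_gt0 // dvdn_leq // andbT.
  by apply: contra neq_mn => /eqP q1; rewrite -(divnK dvd_mn) -q1 mul1n.
set p := pdiv (n %/ m); have p_pr: prime p by apply: pdiv_prime.
have lt_log: (logn p m < logn p n)%N.
  rewrite -(divnK dvd_mn) lognM // ?(ltnW q_gt1) // -addn1 addnC leq_add2r.
  by rewrite logn_gt0 mem_primes p_pr (ltnW q_gt1) pdiv_dvd.
have m_pnat: (m %| n`_p)%N.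
  have /orP[] // := cmp _ (dvdn_part p n).
  by rewrite p_part pfactor_dvdn // leqNgt lt_log.
have m_dvd: (m %| p ^ logn p n)%N by rewrite -p_part.
have p_m: (p %| m)%N.
  case/(dvdn_pfactor _ _ p_pr): m_dvd m_gt1 => -[|i] _ -> //.
  by rewrite expnS dvdn_mulr.
exists p, (logn p n); split=> //; first exact: leq_ltn_trans lt_log.
rewrite -p_part part_pnat_id //; apply/pnatP=> // q q_pr q_n.
have /orP[q_m | m_q] := cmp q q_n.
  by have := dvdn_trans q_m m_dvd; rewrite Euclid_dvdX // dvdn_prime2 // => /andP[].
by have := dvdn_trans p_m m_q; rewrite dvdn_prime2 // eq_sym.
Qed.

Lemma prime_power_dvdn (m n : nat) :
  (1 < m)%N -> (m %| n)%N -> prime_power n -> prime_power m.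
Proof.
move=> m_gt1 dvd_mn [p [k [p_pr _ def_n]]]; move: dvd_mn; rewrite def_n.
case/(dvdn_pfactor _ _ p_pr)=> i _ def_m; exists p, i; split=> //.
by case: i def_m m_gt1 => // ->.
Qed.

Lemma prime_power_comparable (n a b : nat) :
  prime_power n -> (a %| n)%N -> (b %| n)%N -> (a %| b)%N || (b %| a)%N.
Proof.
case=> p [k [p_pr _ ->]] /(dvdn_pfactor _ _ p_pr)[i _ ->].
case/(dvdn_pfactor _ _ p_pr)=> j _ ->.
by case/orP: (leq_total i j) => le_ij; rewrite (dvdn_exp2l p le_ij) ?orbT.
Qed.

(** * Adjacency as incomparability of orders *)

Section DifferenceGraph.
Variables (gT : finGroupType) (G : {group gT}).
Implicit Types (C : {group gT}) (x y u g : gT).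

Local Notation DG := (difference_graph G).

Lemma mem_cycle_order C x y :
  cyclic C -> x \in C -> y \in C -> (x \in <[y]>) = (#[x] %| #[y]).
Proof.
by move=> cC Cx Cy; rewrite -cycle_subG -(cardSg_cyclic cC) ?cycle_subG.
Qed.

Lemma cyclic_has_order C k : cyclic C -> k %| #|C| -> exists2 y, y \in C & #[y] = k.
Proof.
case/cyclicP=> c ->; rewrite -orderE => dvd_k.
exists (c ^+ (#[c] %/ k)); first exact: mem_cycle.
by rewrite orderXdiv ?dvdn_div // divnA // mulKn.
Qed.

Lemma difference_adjE x y :
  adj DG x y = [&& cyclic <<[set x; y]>>, x \notin <[y]> & y \notin <[x]>].
Proof.
rewrite /= /sub_adj /= /power_adj /enhanced_power_adj /=.
by case: eqVneq => [->|] //=; rewrite ?cycle_id ?andbF ?negb_or.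
Qed.

Lemma difference_adj_cyclic C x y :
    cyclic C -> x \in C -> y \in C ->
  adj DG x y = ~~ (#[x] %| #[y]) && ~~ (#[y] %| #[x]).
Proof.
move=> cC Cx Cy; rewrite difference_adjE !(mem_cycle_order cC) //.
by rewrite (cyclicS _ cC) // gen_subG subUset !sub1set Cx.
Qed.

Lemma difference_adjP x y :
  reflect (exists C, [/\ cyclic C, x \in C, y \in C,
                        ~~ (#[x] %| #[y]) & ~~ (#[y] %| #[x])])
          (adj DG x y).
Proof.
apply: (iffP idP) => [adj_xy | [C [cC Cx Cy xy yx]]]; last first.
  by rewrite (difference_adj_cyclic cC) ?xy.
have cC: cyclic <<[set x; y]>> by move: adj_xy; rewrite difference_adjE => /andP[].
have Cx: x \in <<[set x; y]>> by rewrite mem_gen ?set21.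
have Cy: y \in <<[set x; y]>> by rewrite mem_gen ?set22.
move: adj_xy; rewrite (difference_adj_cyclic (C := <<[set x; y]>>%G)) //.
by case/andP; exists <<[set x; y]>>%G.
Qed.

Lemma difference_vertsP x :
  reflect [/\ x \in G & exists2 y, y \in G & adj DG x y] (x \in verts DG).
Proof.
rewrite inE; apply: (iffP andP) => -[Gx].
  by case/exists_inP=> y; split=> //; exists y.
by case=> y Gy xy; split=> //; apply/exists_inP; exists y.
Qed.

(** * Isolated vertices *)

Lemma isolated_maximal_or_prime_power g :
    g \in G -> g != 1 -> g \notin verts DG ->
  maximal_cyclic G <[g]> \/ all_cyclic_overgroups_prime_power G g.
Proof.
move=> Gg g_neq1 isol; have g_gt1: (1 < #[g])%N by rewrite order_gt1.
(* In a cyclic group [C] properly containing [<[g]>], each divisor of [#|C|] is the order of some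
   element. As [g] is not adjacent to that element, the divisor is comparable with [#[g]]. *)
have pp C: C \subset G -> cyclic C -> g \in C -> <[g]> != C -> prime_power #|C|.
  move=> sCG cC Cg neqC; have dvd_g: #[g] %| #|C| by apply: order_dvdG.
  apply: (prime_power_of_comparable_divisors g_gt1) => //.
    by apply: contra neqC => /eqP eq_gC; rewrite eqEcard cycle_subG Cg -eq_gC /=.
  move=> k /(cyclic_has_order cC)[y Cy <-]; apply/idPn; rewrite negb_or.
  case/andP=> yg gy; case/difference_vertsP: isol; split=> //.
  by exists y; [apply: (subsetP sCG) | rewrite (difference_adj_cyclic cC) ?gy].
have [|C0 maxC0 sgC0] := @maxgroup_exists _ [pred C : {group gT} | (C \subset G) && cyclic C] <[g]>%G.
  by rewrite /= cycle_subG Gg cycle_cyclic.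
have [/andP[sC0G cC0] _] := maxgroupP maxC0.
have [eqC0 | neqC0] := eqVneq <[g]> (C0 : {set gT}).
  by left; rewrite /maximal_cyclic eqC0.
(* [pp] leaves out the overgroup [<[g]>] itself. Its order divides that of the strictly larger [C0],
   to which [pp] applies. *)
right=> C sCG cC Cg; have [eqC | neqC] := eqVneq <[g]> (C : {set gT}).
  rewrite -eqC; apply: prime_power_dvdn (cardSg sgC0) _ => //.
  by apply: pp; rewrite // -cycle_subG.
exact: pp.
Qed.

Lemma maximal_cyclic_isolated g : maximal_cyclic G <[g]> -> g \notin verts DG.
Proof.
case/maxgroupP=> _ maxg; apply/difference_vertsP=> -[Gg [y Gy]].
rewrite difference_adjE => /and3P[cgy _ /negP[]].
rewrite -(maxg <<[set g; y]>>%G) /=.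
- by rewrite mem_gen ?set22.
- by rewrite cgy gen_subG subUset !sub1set Gg Gy.
by rewrite cycle_subG mem_gen ?set21.
Qed.

(** The divisors of a prime power form a chain, so no element of a cyclic overgroup of [g] has order
    incomparable with [#[g]]. *)
Lemma prime_power_isolated g :
  all_cyclic_overgroups_prime_power G g -> g \notin verts DG.
Proof.
move=> ppg; apply/difference_vertsP=> -[Gg [y Gy]].
rewrite difference_adjE => /and3P[cgy]; pose C := <<[set g; y]>>%G.
have Cg: g \in C by rewrite mem_gen ?set21.
have Cy: y \in C by rewrite mem_gen ?set22.
have sCG: C \subset G by rewrite gen_subG subUset !sub1set Gg Gy.
rewrite !(mem_cycle_order (C := C)) // => /negPf gy /negPf yg.
have := prime_power_comparable (ppg C sCG cgy Cg) (order_dvdG Cg) (order_dvdG Cy).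
by rewrite gy yg.
Qed.

(** * Neighbours of an involution *)

Lemma cyclic_involution_commute u g :
    #[u] = 2 -> odd #[g] -> commute u g ->
  [/\ cyclic <[u * g]>, u \in <[u * g]> & g \in <[u * g]>].
Proof.
move=> ou og cug; have cop: coprime #[u] #[g] by rewrite ou coprime2n.
split; first exact: cycle_cyclic.
  by rewrite cycleM // (subsetP (mulG_subl _ _)) ?cycle_id.
by rewrite cycleM // (subsetP (mulG_subr _ _)) ?cycle_id.
Qed.

Lemma involution_adj u g :
  #[u] = 2 -> adj DG u g = [&& g != 1, odd #[g] & u * g == g * u].
Proof.
move=> ou; apply/difference_adjP/and3P=> [[C [cC Cu Cg ug gu]] | [g1 og /eqP cug]].
  split; first by apply: contra gu => /eqP->; rewrite order1 dvd1n.
    by move: ug; rewrite ou dvdn2 negbK.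
  by apply/eqP; apply: (centsP (cyclic_abelian cC)).
have [cC Cu Cg] := cyclic_involution_commute ou og cug.
exists <[u * g]>%G; split=> //; rewrite ou ?dvdn2 ?negbK //.
apply/negP=> /(prime_nt_dvdP (isT : prime 2)) g2.
by rewrite g2 // order_eq1 in og.
Qed.

Lemma dominating1P u :
  reflect (u \in verts DG /\ forall x, x \in verts DG -> x != u -> adj DG u x)
          (dominating DG [set u]).
Proof.
rewrite /dominating sub1set; apply: (iffP andP) => -[Vu domu]; split=> //.
  move=> x Vx; have:= forall_inP domu x Vx; rewrite inE => /orP[-> // |].
  by case/exists_inP=> y /set1P->; rewrite adj_sym.
apply/forall_inP=> x Vx; rewrite inE; case: eqVneq => // neq_xu.
by apply/exists_inP; exists u; rewrite ?set11 // adj_sym domu.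
Qed.

Lemma domination_number1P :
  domination_number DG = 1%N <-> exists u, dominating DG [set u].
Proof.
rewrite /domination_number; case: arg_minnP => [|D domD minD].
  exact: dominating_verts.
split=> [/eqP/cards1P[u defD] | [u domu]]; first by exists u; rewrite -defD.
apply/eqP; rewrite eqn_leq -{1}(cards1 u) minD //= card_gt0.
(* The minimum is not 0, since the empty set fails to dominate the vertex [u]. *)
apply: contraTneq domD => ->; have [Vu _] := dominating1P _ domu.
rewrite negb_and; apply/orP; right; apply/forall_inPn; exists u => //.
by rewrite inE /=; apply/exists_inPn=> y; rewrite inE.
Qed.

Lemma dominating_order u : dominating DG [set u] -> #[u] = 2.
Proof.
case/dominating1P=> Vu domu; have [Gu [y Gy uy]] := difference_vertsP _ Vu.
have u1: u != 1.
  by apply: contraTneq uy => ->; rewrite difference_adjE group1 andbF.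
suff /eqP uV: u^-1 == u.
  apply/prime_nt_dvdP; rewrite ?order_eq1 // order_dvdn expgS expg1.
  by rewrite -{1}uV mulVg.
apply: contraT => neq; suff: adj DG u u^-1 by rewrite difference_adjE groupV cycle_id !andbF.
apply: domu neq; apply/difference_vertsP; rewrite groupV; split=> //; exists y => //.
case/difference_adjP: uy => C [cC Cu Cy ? ?]; apply/difference_adjP.
by exists C; rewrite groupV orderV.
Qed.

Lemma dominating_unique_involution u :
  dominating DG [set u] -> unique (involution_commuting_odd_prime G) u.
Proof.
move=> domu; have ou := dominating_order domu.
have [Vu adju] := dominating1P _ domu; have [Gu [y Gy]] := difference_vertsP _ Vu.
rewrite involution_adj // => /and3P[y1 oy /eqP cuy].
split.
  (* A neighbour [y] of [u] has odd order and commutes with [u]; a suitable power of [y] has prime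
     order as well. *)
  have p_pr: prime (pdiv #[y]) by rewrite pdiv_prime ?order_gt1.
  have [z yz oz] := cyclic_has_order (cycle_cyclic y) (pdiv_dvd #[y]).
  split=> //; exists z; first by apply: subsetP yz; rewrite cycle_subG.
  rewrite oz; split=> //; first exact: dvdn_odd (pdiv_dvd _) oy.
  by case/cycleP: yz => i ->; apply: commuteX.
(* Another such involution [v] is adjacent to [g], hence a vertex, hence adjacent to [u]; but
   neighbours of [u] have odd order. *)
move=> v [Gv ov [g Gg [g_pr og cvg]]]; apply/eqP; rewrite eq_sym.
apply: contraT => neq_vu; have: adj DG u v.
  apply: adju neq_vu; apply/difference_vertsP; split=> //; exists g => //.
  by rewrite involution_adj // og cvg eqxx -order_gt1 prime_gt1.
by rewrite involution_adj // ov andbF.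
Qed.

Lemma dominating_odd_prime u g :
    dominating DG [set u] -> g \in verts DG -> odd #[g] ->
  prime #[g] /\ commute g u.
Proof.
move=> domu Vg og; have ou := dominating_order domu.
have [Vu adju] := dominating1P _ domu; have [Gu _] := difference_vertsP _ Vu.
have [Gg _] := difference_vertsP _ Vg.
have gu: g != u by apply: contraTneq og => ->; rewrite ou.
have := adju g Vg gu; rewrite involution_adj // => /and3P[g1 _ /eqP cug].
split; last exact: commute_sym.
apply: contraT => g_npr; pose p := pdiv #[g].
have p_pr: prime p by rewrite pdiv_prime ?order_gt1.
have [z gz oz] := cyclic_has_order (cycle_cyclic g) (pdiv_dvd #[g]).
have [cC Cu Cg] := cyclic_involution_commute ou og cug.
have Cz: z \in <[u * g]> by apply: subsetP gz; rewrite cycle_subG.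
have cuz: commute u z by apply: (centsP (cyclic_abelian cC)).
have odd_p: odd p by apply: dvdn_odd (pdiv_dvd _) og.
have ouz: #[u * z] = (2 * p)%N by rewrite orderM // ou oz // coprime2n.
have Vuz: u * z \in verts DG.
  apply/difference_vertsP; split; first by rewrite groupM // (subsetP _ _ Cz) // cycle_subG groupM.
  (* The orders [2 * p] and [#[g]] are incomparable: [#[g]] is odd, and if it divided [2 * p] it
     would divide [p], hence equal [p] and be prime. *)
  exists g => //; rewrite (difference_adj_cyclic cC) ?groupM // ouz; apply/andP; split.
    by apply: contraL og => /(dvdn_trans (dvdn_mulr p (dvdnn 2))); rewrite dvdn2.
  rewrite Gauss_dvdr ?coprimen2 //; apply: contra g_npr => gp.
  by have /eqP->: #[g] == p by rewrite eqn_dvd gp pdiv_dvd.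
have neq: u * z != u.
  apply: contraTneq p_pr => eq_uz.
  have z1: z = 1 by apply: (mulgI u); rewrite mulg1.
  by rewrite /p -oz z1 order1.
by have := adju _ Vuz neq; rewrite involution_adj // ouz oddM andbF.
Qed.

Lemma dominating_Phi u : dominating DG [set u] -> Phi_group G.
Proof.
move=> domu; exists u; split; first exact: dominating_unique_involution.
  move=> g Gg g1 og; have [Vg | /isolated_maximal_or_prime_power[] //] := boolP (g \in verts DG).
  - by constructor 3; apply: dominating_odd_prime.
  - by constructor 1.
  by constructor 2.
move=> g Gg gu eg; apply: isolated_maximal_or_prime_power => //.
  by apply: contraNneq eg => ->; rewrite order1.
have [_ adju] := dominating1P _ domu; apply/negP=> Vg; have := adju g Vg gu.
by rewrite (involution_adj _ (dominating_order domu)) (negPf eg) andbF.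
Qed.

(** The first two alternatives of the odd case, and both of the even case, make an element isolated.
    So a vertex other than [u] has odd order and commutes with [u], which makes it a neighbour of
    [u]. *)
Lemma Phi_dominating : Phi_group G -> exists u, dominating DG [set u].
Proof.
case=> u [[[Gu ou [h Gh [h_pr oh cuh]]] _] odd_case even_case].
exists u; apply/dominating1P; split.
  apply/difference_vertsP; split=> //; exists h => //.
  by rewrite involution_adj // oh cuh eqxx -order_gt1 prime_gt1.
move=> x Vx xu; have [Gx [y _ xy]] := difference_vertsP _ Vx.
have x1: x != 1.
  by apply: contraTneq xy => ->; rewrite difference_adjE group1 andbF.
have [ox | ex] := boolP (odd #[x]).
  have [/maximal_cyclic_isolated/negP[] // | /prime_power_isolated/negP[] // | [_ cxu]] := odd_case x Gx x1 ox.
  by rewrite involution_adj // x1 ox cxu eqxx.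
by have [/maximal_cyclic_isolated/negP[] | /prime_power_isolated/negP[]] := even_case x Gx xu ex.
Qed.

End DifferenceGraph.

Theorem theorem3p3 (gT : finGroupType) (G : {group gT}) :
  (domination_number (difference_graph G) = 1%N <-> Phi_group G) /\
  (domination_number (difference_graph G) = 1%N ->
   exists u : gT,
     unique (involution_commuting_odd_prime G) u /\
     unique (fun D : {set gT} => dominating (difference_graph G) D /\ #|D| = 1%N)
            [set u]).
Proof.
split.
  split=> [/domination_number1P[u /dominating_Phi] // | /Phi_dominating].
  by move/domination_number1P.
case/domination_number1P=> u domu; have uniq_u := dominating_unique_involution domu.
exists u; split=> //; split=> [|D [domD /eqP/cards1P[v defD]]].
  by rewrite cards1.
(* A second dominating vertex [v] is also an involution commuting with an element of odd prime
   order, and [u] is the only one. *)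
rewrite defD in domD *; have [inv_v _] := dominating_unique_involution domD.
by congr [set _]; apply: (proj2 uniq_u).
Qed.
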